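(* Let $M$ be a right $S^3_q$-module and let $\nabla$ be a right $q$-affine connection on $M$. Let $p:M\to M$ be a projection, i.e. an endomorphism of the right $S^3_q$-module $M$ such that $p^2=p$. Then $p\circ\nabla$, i.e. the map $(X,m)\mapsto p(\nabla_Xm)$ for $X\in TS^3_q$ and $m\in p(M)$, is a right $q$-affine connection on the right $S^3_q$-module $p(M)$.
   Context: Let $q>0$ be real, $q\neq 1$. $S^3_q$ is the unital complex $*$-algebra generated by $a,a^*,c,c^*$ with relations $ac=qca$, $c^*a^*=qa^*c^*$, $ac^*=qc^*a$, $ca^*=qa^*c$, $cc^*=c^*c$, $a^*a+c^*c=aa^*+q^2cc^*=\mathbf 1$. $\mathcal U_q(\mathrm{su}(2))$ is the algebra generated by $E,F,K,K^{-1}$ with $K^{\pm1}E=q^{\pm1}EK^{\pm1}$, $K^{\pm1}F=q^{\mp1}FK^{\pm1}$, $[E,F]=\frac{K^2-K^{-2}}{q-q^{-1}}$, and coproduct $\Delta(E)=E\otimes K+K^{-1}\otimes E$, $\Delta(F)=F\otimes K+K^{-1}\otimes F$, $\Delta(K^{\pm1})=K^{\pm1}\otimes K^{\pm1}$ (counit $\epsilon(K)=1$, $\epsilon(E)=\epsilon(F)=0$). It acts on $S^3_q$ from the left; the action is written $h(f)$ (or $h\triangleright f$), makes $S^3_q$ a left module algebra, $h(fg)=h_{(1)}(f)\,h_{(2)}(g)$ and $h(\mathbf 1)=\epsilon(h)\mathbf 1$, and is determined by $K^{\pm1}(a)=q^{\mp1/2}a$, $K^{\pm1}(c)=q^{\mp1/2}c$,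 $K^{\pm1}(a^* )=q^{\pm1/2}a^*$, $K^{\pm1}(c^* )=q^{\pm1/2}c^*$; $E(a)=-qc^*$, $E(c)=a^*$, $E(a^* )=E(c^* )=0$; $F(a)=F(c)=0$, $F(a^* )=c$, $F(c^* )=-q^{-1}a$. Set $X_+=\sqrt q\,EK$, $X_-=\frac1{\sqrt q}FK$, $X_z=\frac{1-K^4}{1-q^{-2}}$, and $\sigma_+=\sigma_-=K^2$, $\sigma_z=K^4$, all acting on $S^3_q$ by the left action; then $X_a(fg)=fX_a(g)+X_a(f)\sigma_a(g)$ for $a\in\{+,-,z\}$. The quantum tangent space $TS^3_q$ is the complex vector space spanned by $X_+,X_-,X_z$. A right $q$-affine connection on a right $S^3_q$-module $M$ is a map $\nabla:TS^3_q\times M\to M$, $(X,m)\mapsto\nabla_Xm$, that is $\mathbb C$-linear in each argument and satisfies $\nabla_{X_a}(mf)=(\nabla_{X_a}m)\sigma_a(f)+mX_a(f)$ for $a\in\{+,-,z\}$, $m\in M$, $f\in S^3_q$. *)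

(* Defs.v *)
From HB Require Import structures.
From mathcomp Require Import all_boot all_order all_algebra.
From mathcomp Require Import generic_quotient.
From mathcomp Require Import boolp reals.
From mathcomp Require Import complex.
From mathcomp Require Import ring.

Set Implicit Arguments.
Unset Strict Implicit.
Unset Printing Implicit Defensive.

Import Order.TTheory GRing.Theory Num.Theory.
Local Open Scope ring_scope.
Local Open Scope complex_scope.
Local Open Scope quotient_scope.

(* Unital associative algebras presented by generators and relations: formal
   noncommutative polynomial expressions modulo the least congruence that
   contains the axioms of unital K-algebras and the given relations. *)

Inductive term (K G : Type) : Type :=
| Cst of K
| Gen of G
| Add of term K G & term K G
| Mul of term K G & term K G.

Arguments Cst {K G}.
Arguments Gen {K G}.

HB.instance Definition _ (K G : Type) := gen_eqMixin (term K G).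
HB.instance Definition _ (K G : Type) := gen_choiceMixin (term K G).

Declare Scope expr_scope.
Delimit Scope expr_scope with expr.
Bind Scope expr_scope with term.
Local Notation "s + t" := (Add s t) : expr_scope.
Local Notation "s * t" := (Mul s t) : expr_scope.
Local Notation "x *: t" := (Mul (Cst x%R) t) : expr_scope.
Local Notation "s - t" := (Add s (Mul (Cst (-1)%R) t)) : expr_scope.

Section Congruence.
Variables (K : comNzRingType) (G : Type).
Variable rel : term K G -> term K G -> Prop.

Inductive cong : term K G -> term K G -> Prop :=
| cong_rel s t : rel s t -> cong s t
| cong_refl t : cong t t
| cong_sym s t : cong s t -> cong t s
| cong_trans s t u : cong s t -> cong t u -> cong s u
| cong_add s s' t t' : cong s s' -> cong t t' -> cong (s + t) (s' + t')
| cong_mul s s' t t' : cong s s' -> cong t t' -> cong (s * t) (s' * t')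
| cong_addA s t u : cong (s + (t + u)) (s + t + u)
| cong_addC s t : cong (s + t) (t + s)
| cong_add0 t : cong (Cst 0 + t) t
| cong_addN t : cong (t - t) (Cst 0)
| cong_mulA s t u : cong (s * (t * u)) (s * t * u)
| cong_mul1 t : cong (Cst 1 * t) t
| cong_mulDl s t u : cong ((s + t) * u) (s * u + t * u)
| cong_mulDr s t u : cong (s * (t + u)) (s * t + s * u)
| cong_cstD x y : cong (Cst (x + y)) (Cst x + Cst y)
| cong_cstM x y : cong (Cst (x * y)) (Cst x * Cst y)
| cong_cstC x t : cong (Cst x * t) (t * Cst x).

Definition congb (s t : term K G) : bool := `[< cong s t >].

Lemma congb_refl : reflexive congb.
Proof. by move=> t; apply/asboolP/cong_refl. Qed.

Lemma congb_sym : symmetric congb.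
Proof. by move=> s t; apply/asboolP/asboolP => /cong_sym. Qed.

Lemma congb_trans : transitive congb.
Proof.
move=> t s u /asboolP st /asboolP tu.
by apply/asboolP; apply: cong_trans st tu.
Qed.

Canonical congb_equiv := EquivRel congb congb_refl congb_sym congb_trans.

Definition presalg := {eq_quot congb_equiv}%qT.
HB.instance Definition _ := Choice.on presalg.
HB.instance Definition _ := EqQuotient.on presalg.

Implicit Types x y z : presalg.

Definition cls (t : term K G) : presalg := \pi t.

Lemma clsP s t : cls s = cls t <-> cong s t.
Proof.
split=> [e | st]; first by move/eqquotP/asboolP: e.
by apply/eqquotP; apply/asboolP.
Qed.

Lemma cls_rel s t : rel s t -> cls s = cls t.
Proof. by move=> st; apply/clsP/cong_rel. Qed.

Lemma clsK x : cls (repr x) = x.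
Proof. exact: reprK. Qed.

Definition pres_add x y : presalg := cls (repr x + repr y)%expr.
Definition pres_mul x y : presalg := cls (repr x * repr y)%expr.
Definition pres_opp x : presalg := cls (Cst (-1) * repr x)%expr.

Lemma cong_repr t : cong (repr (cls t)) t.
Proof. by apply/clsP; rewrite clsK. Qed.

Lemma pres_addE s t : pres_add (cls s) (cls t) = cls (s + t)%expr.
Proof. by apply/clsP; apply: cong_add; apply: cong_repr. Qed.

Lemma pres_mulE s t : pres_mul (cls s) (cls t) = cls (s * t)%expr.
Proof. by apply/clsP; apply: cong_mul; apply: cong_repr. Qed.

Lemma pres_oppE t : pres_opp (cls t) = cls (Cst (-1) * t)%expr.
Proof.
by apply/clsP; apply: cong_mul; [apply: cong_refl | apply: cong_repr].
Qed.

Lemma pres_addA : associative pres_add.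
Proof.
move=> x y z; rewrite -[x]clsK -[y]clsK -[z]clsK !pres_addE.
exact/clsP/cong_addA.
Qed.

Lemma pres_addC : commutative pres_add.
Proof.
by move=> x y; rewrite -[x]clsK -[y]clsK !pres_addE; apply/clsP/cong_addC.
Qed.

Lemma pres_add0 : left_id (cls (Cst 0)) pres_add.
Proof. by move=> x; rewrite -[x]clsK pres_addE; apply/clsP/cong_add0. Qed.

Lemma pres_mulA : associative pres_mul.
Proof.
move=> x y z; rewrite -[x]clsK -[y]clsK -[z]clsK !pres_mulE.
exact/clsP/cong_mulA.
Qed.

Lemma pres_mul1l : left_id (cls (Cst 1)) pres_mul.
Proof. by move=> x; rewrite -[x]clsK pres_mulE; apply/clsP/cong_mul1. Qed.

Lemma pres_mul1r : right_id (cls (Cst 1)) pres_mul.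
Proof.
move=> x; rewrite -[x]clsK pres_mulE; apply/clsP.
exact: cong_trans (cong_sym (cong_cstC _ _)) (cong_mul1 _).
Qed.

Lemma pres_mulDl : left_distributive pres_mul pres_add.
Proof.
move=> x y z; rewrite -[x]clsK -[y]clsK -[z]clsK.
by rewrite !(pres_mulE, pres_addE); apply/clsP/cong_mulDl.
Qed.

Lemma pres_mulDr : right_distributive pres_mul pres_add.
Proof.
move=> x y z; rewrite -[x]clsK -[y]clsK -[z]clsK.
by rewrite !(pres_mulE, pres_addE); apply/clsP/cong_mulDr.
Qed.

Lemma pres_cstD a b :
  cls (Cst (a + b)) = pres_add (cls (Cst a)) (cls (Cst b)).
Proof. by rewrite pres_addE; apply/clsP/cong_cstD. Qed.

Lemma pres_cstM a b :
  cls (Cst (a * b)) = pres_mul (cls (Cst a)) (cls (Cst b)).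
Proof. by rewrite pres_mulE; apply/clsP/cong_cstM. Qed.

Lemma pres_cstC a x : pres_mul (cls (Cst a)) x = pres_mul x (cls (Cst a)).
Proof. by rewrite -[x]clsK !pres_mulE; apply/clsP/cong_cstC. Qed.

Lemma pres_addN : left_inverse (cls (Cst 0)) pres_opp pres_add.
Proof.
move=> x; rewrite -[x]clsK pres_oppE pres_addC pres_addE.
exact/clsP/cong_addN.
Qed.

HB.instance Definition _ := GRing.isZmodule.Build presalg
  pres_addA pres_addC pres_add0 pres_addN.
HB.instance Definition _ := GRing.Zmodule_isPzRing.Build presalg
  pres_mulA pres_mul1l pres_mul1r pres_mulDl pres_mulDr.

Definition pcst (a : K) : presalg := cls (Cst a).
Definition pgen (g : G) : presalg := cls (Gen g).

Lemma clsD s t : cls (s + t)%expr = cls s + cls t.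
Proof. by rewrite -pres_addE. Qed.

Lemma clsM s t : cls (s * t)%expr = cls s * cls t.
Proof. by rewrite -pres_mulE. Qed.

Definition pres_scale (a : K) x : presalg := pcst a * x.

Lemma pres_scaleA a b x :
  pres_scale a (pres_scale b x) = pres_scale (a * b) x.
Proof. by rewrite /pres_scale mulrA /pcst pres_cstM. Qed.

Lemma pres_scale1 : left_id 1 pres_scale.
Proof. by move=> x; apply: mul1r. Qed.

Lemma pres_scaleDr : right_distributive pres_scale +%R.
Proof. by move=> a x y; apply: mulrDr. Qed.

Lemma pres_scaleDl x : {morph pres_scale^~ x : a b / a + b}.
Proof.
move=> a b; by rewrite /pres_scale -mulrDl /pcst pres_cstD.
Qed.

HB.instance Definition _ := GRing.Zmodule_isLmodule.Build K presalg
  pres_scaleA pres_scale1 pres_scaleDr pres_scaleDl.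

Lemma pscaleE a x : a *: x = pcst a * x.
Proof. by []. Qed.

Lemma pscaleAl a x y : a *: (x * y) = (a *: x) * y.
Proof. by rewrite !pscaleE mulrA. Qed.

Lemma pscaleAr a x y : a *: (x * y) = x * (a *: y).
Proof.
rewrite !pscaleE !mulrA; congr (_ * y); exact: pres_cstC.
Qed.

Lemma cls_ind (P : presalg -> Prop) :
    (forall a, P (pcst a)) -> (forall g, P (pgen g)) ->
    (forall x y, P x -> P y -> P (x + y)) ->
    (forall x y, P x -> P y -> P (x * y)) ->
  forall x, P x.
Proof.
move=> Pc Pg PD PM x; rewrite -[x]clsK.
elim: (repr x) => [a|g|s Ps t Pt|s Ps t Pt].
- exact: Pc.
- exact: Pg.
- by rewrite clsD; apply: PD.
- by rewrite clsM; apply: PM.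
Qed.

Lemma pcst_is_zmod_morphism : zmod_morphism pcst.
Proof.
move=> a b; apply: (addIr (pcst b)); rewrite subrK.
by rewrite -[LHS](pres_cstD (a - b) b) subrK.
Qed.

Lemma pcst_is_monoid_morphism : monoid_morphism pcst.
Proof. by split=> // a b; rewrite /pcst pres_cstM. Qed.

HB.instance Definition _ :=
  GRing.isZmodMorphism.Build K presalg pcst pcst_is_zmod_morphism.
HB.instance Definition _ :=
  GRing.isMonoidMorphism.Build K presalg pcst pcst_is_monoid_morphism.

Lemma pcstC a x : pcst a * x = x * pcst a.
Proof. exact: pres_cstC. Qed.

Section Lift.
Variables (B : pzRingType) (phi : {rmorphism K -> B}) (g : G -> B).

Fixpoint peval (t : term K G) : B :=
  match t with
  | Cst a => phi a
  | Gen i => g i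
  | Add s t => peval s + peval t
  | Mul s t => peval s * peval t
  end.

Definition plift x : B := peval (repr x).

Hypothesis phiC : forall a b, phi a * b = b * phi a.
Hypothesis peval_rel : forall s t, rel s t -> peval s = peval t.

Lemma peval_cong s t : cong s t -> peval s = peval t.
Proof.
elim=> {s t} //=.
- by move=> s t u _ -> _ ->.
- by move=> s s' t t' _ -> _ ->.
- by move=> s s' t t' _ -> _ ->.
- by move=> *; rewrite addrA.
- by move=> *; rewrite addrC.
- by move=> *; rewrite rmorph0 add0r.
- by move=> *; rewrite rmorphN1 mulN1r subrr rmorph0.
- by move=> *; rewrite mulrA.
- by move=> *; rewrite rmorph1 mul1r.
- by move=> *; rewrite mulrDl.
- by move=> *; rewrite mulrDr.
- by move=> *; rewrite rmorphD.
- by move=> *; rewrite rmorphM.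
Qed.

Lemma plift_cls t : plift (cls t) = peval t.
Proof. exact/peval_cong/cong_repr. Qed.

Lemma plift_cst a : plift (pcst a) = phi a.
Proof. exact: plift_cls. Qed.

Lemma plift_gen i : plift (pgen i) = g i.
Proof. exact: plift_cls. Qed.

Lemma pliftD x y : plift (x + y) = plift x + plift y.
Proof. by rewrite -[x]clsK -[y]clsK -clsD !plift_cls. Qed.

Lemma pliftM x y : plift (x * y) = plift x * plift y.
Proof. by rewrite -[x]clsK -[y]clsK -clsM !plift_cls. Qed.
End Lift.

(* The K-linear map D with D g = d g on generators and
   D (x y) = D x * k y + l x * D y. *)
Section SkewDerivation.
Variables (k l : presalg -> presalg) (d : G -> presalg).

Fixpoint skew_eval (t : term K G) : presalg :=
  match t with
  | Cst _ => 0
  | Gen i => d i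
  | Add s t => skew_eval s + skew_eval t
  | Mul s t => skew_eval s * k (cls t) + l (cls s) * skew_eval t
  end.

Definition skew x : presalg := skew_eval (repr x).

Hypothesis kc : forall a, k (pcst a) = pcst a.
Hypothesis kD : forall x y, k (x + y) = k x + k y.
Hypothesis kM : forall x y, k (x * y) = k x * k y.
Hypothesis lc : forall a, l (pcst a) = pcst a.
Hypothesis lD : forall x y, l (x + y) = l x + l y.
Hypothesis lM : forall x y, l (x * y) = l x * l y.
Hypothesis skew_eval_rel : forall s t, rel s t -> skew_eval s = skew_eval t.

Lemma skew_eval_cong s t : cong s t -> skew_eval s = skew_eval t.
Proof.
elim=> {s t} //=.
- by move=> s t u _ -> _ ->.
- by move=> s s' t t' _ -> _ ->.
- move=> s s' t t' ss' -> tt' ->.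
  by rewrite (proj2 (clsP _ _) ss') (proj2 (clsP _ _) tt').
- by move=> *; rewrite addrA.
- by move=> *; rewrite addrC.
- by move=> *; rewrite add0r.
- by move=> t; rewrite -/(pcst _) lc rmorphN1 mulN1r mul0r add0r subrr.
- move=> s t u; rewrite !clsM kM lM !mulrDl !mulrDr.
  by rewrite !mulrA addrA.
- by move=> t; rewrite -/(pcst _) lc rmorph1 mul0r add0r mul1r.
- by move=> s t u; rewrite clsD lD !mulrDl addrACA.
- by move=> s t u; rewrite clsD kD !mulrDr addrACA.
- by rewrite addr0.
- by move=> *; rewrite mul0r mulr0 addr0.
- move=> a t; rewrite -/(pcst _) kc lc mul0r mulr0 add0r addr0.
  exact: pcstC.
Qed.

Lemma skew_cls t : skew (cls t) = skew_eval t.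
Proof. exact/skew_eval_cong/cong_repr. Qed.

Lemma skew_cst a : skew (pcst a) = 0.
Proof. exact: skew_cls. Qed.

Lemma skew_gen i : skew (pgen i) = d i.
Proof. exact: skew_cls. Qed.

Lemma skewD x y : skew (x + y) = skew x + skew y.
Proof. by rewrite -[x]clsK -[y]clsK -clsD !skew_cls. Qed.

Lemma skewM x y : skew (x * y) = skew x * k y + l x * skew y.
Proof. by rewrite -[x]clsK -[y]clsK -clsM !skew_cls. Qed.
End SkewDerivation.

End Congruence.

Arguments cls {K G} rel t.
Arguments pcst {K G} rel a.
Arguments pgen {K G} rel g.

Section QuantumSphere.
Variables (R : realType) (q : R).
Local Notation C := R[i].

(* [Sas] and [Scs] stand for the generators a^* and c^*. *)
Inductive sphere_gen := Sa | Sas | Sc | Scs.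

Local Notation a := (Gen Sa).
Local Notation as_ := (Gen Sas).
Local Notation c := (Gen Sc).
Local Notation cs := (Gen Scs).

Inductive sphere_rel : term C sphere_gen -> term C sphere_gen -> Prop :=
| rel_ac : sphere_rel (a * c) (q%:C *: (c * a))
| rel_csas : sphere_rel (cs * as_) (q%:C *: (as_ * cs))
| rel_acs : sphere_rel (a * cs) (q%:C *: (cs * a))
| rel_cas : sphere_rel (c * as_) (q%:C *: (as_ * c))
| rel_ccs : sphere_rel (c * cs) (cs * c)
| rel_asa : sphere_rel (as_ * a + cs * c) (Cst 1)
| rel_aas : sphere_rel (a * as_ + q%:C ^+ 2 *: (c * cs)) (Cst 1).

Definition S3q := presalg sphere_rel.
HB.instance Definition _ := GRing.PzRing.on S3q.
HB.instance Definition _ := GRing.Lmodule.on S3q.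

Definition sphere_counit : S3q -> C :=
  plift idfun (fun g => if g is (Sa | Sas) then 1 else 0).

Lemma S3q_one_neq0 : (1 : S3q) != 0.
Proof.
have rP (s t : term C sphere_gen) : sphere_rel s t ->
    peval idfun (fun g => if g is (Sa | Sas) then 1 else 0 : C) s =
    peval idfun (fun g => if g is (Sa | Sas) then 1 else 0 : C) t.
  by case=> /=; rewrite ?(mulr0, mul0r, mul1r, addr0).
have cE (z : C) : sphere_counit (pcst _ z) = z.
  by apply: plift_cst => //= ? ?; rewrite mulrC.
apply/eqP => /(congr1 sphere_counit).
by rewrite -(rmorph1 (pcst _)) -(rmorph0 (pcst _)) !cE => /eqP; rewrite oner_eq0.
Qed.

HB.instance Definition _ := GRing.PzSemiRing_isNonZero.Build S3q S3q_one_neq0.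
HB.instance Definition _ := GRing.Lmodule_isLalgebra.Build C S3q
  (@pscaleAl _ _ _).
HB.instance Definition _ := GRing.Lalgebra_isAlgebra.Build C S3q
  (@pscaleAr _ _ _).

Definition ga : S3q := pgen sphere_rel Sa.
Definition gas : S3q := pgen sphere_rel Sas.
Definition gc : S3q := pgen sphere_rel Sc.
Definition gcs : S3q := pgen sphere_rel Scs.

Lemma S3q_pcstE z : pcst sphere_rel z = z%:A :> S3q.
Proof. by rewrite pscaleE mulr1. Qed.

Lemma S3q_ac : ga * gc = q%:C *: (gc * ga) :> S3q.
Proof. by have := cls_rel rel_ac; rewrite !(clsM, clsD). Qed.
Lemma S3q_csas : gcs * gas = q%:C *: (gas * gcs) :> S3q.
Proof. by have := cls_rel rel_csas; rewrite !(clsM, clsD). Qed.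
Lemma S3q_acs : ga * gcs = q%:C *: (gcs * ga) :> S3q.
Proof. by have := cls_rel rel_acs; rewrite !(clsM, clsD). Qed.
Lemma S3q_cas : gc * gas = q%:C *: (gas * gc) :> S3q.
Proof. by have := cls_rel rel_cas; rewrite !(clsM, clsD). Qed.
Lemma S3q_ccs : gc * gcs = gcs * gc :> S3q.
Proof. by have := cls_rel rel_ccs; rewrite !(clsM, clsD). Qed.
Lemma S3q_asa : gas * ga + gcs * gc = 1 :> S3q.
Proof. by have := cls_rel rel_asa; rewrite !(clsM, clsD). Qed.
Lemma S3q_aas : ga * gas + q%:C ^+ 2 *: (gc * gcs) = 1 :> S3q.
Proof. by have := cls_rel rel_aas; rewrite !(clsM, clsD). Qed.

Lemma S3q_ind (P : S3q -> Prop) :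
    (forall z : C, P z%:A) -> P ga -> P gas -> P gc -> P gcs ->
    (forall x y, P x -> P y -> P (x + y)) ->
    (forall x y, P x -> P y -> P (x * y)) ->
  forall x, P x.
Proof.
move=> Pz Pa Pas Pc Pcs PD PM; apply: cls_ind => //.
- by move=> z; rewrite S3q_pcstE; apply: Pz.
- by case.
Qed.

(* The star is conjugate-linear and antimultiplicative: a ring homomorphism into
   the opposite algebra lying over complex conjugation. *)

Lemma S3q_mulc (x y : S3q) : (x : S3q^c) * (y : S3q^c) = y * x :> S3q.
Proof. by []. Qed.

Definition conj_cst (z : C) : S3q^c := z^*%:A : S3q.

Lemma conj_cst_is_zmod_morphism : zmod_morphism conj_cst.
Proof. by move=> x y; rewrite /conj_cst raddfB scalerBl. Qed.

Lemma conj_cst_is_monoid_morphism : monoid_morphism conj_cst.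
Proof.
split=> [|x y]; first by rewrite /conj_cst rmorph1 scale1r.
by rewrite /conj_cst S3q_mulc rmorphM -scalerAl mul1r scalerA mulrC.
Qed.

HB.instance Definition _ :=
  GRing.isZmodMorphism.Build C S3q^c conj_cst conj_cst_is_zmod_morphism.
HB.instance Definition _ :=
  GRing.isMonoidMorphism.Build C S3q^c conj_cst conj_cst_is_monoid_morphism.

Definition star_gen (g : sphere_gen) : S3q^c :=
  match g with Sa => gas | Sas => ga | Sc => gcs | Scs => gc end.

Definition star (x : S3q) : S3q :=
  plift (B := S3q^c) conj_cst star_gen x.

Lemma conj_cstC z (x : S3q^c) : conj_cst z * x = x * conj_cst z.
Proof.
by rewrite /conj_cst !S3q_mulc -scalerAr -scalerAl mulr1 mul1r.
Qed.

Lemma star_rel s t : sphere_rel s t ->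
  peval conj_cst star_gen s = peval conj_cst star_gen t.
Proof.
have cM z (x : S3q^c) : conj_cst z * x = z^* *: (x : S3q).
  by rewrite /conj_cst S3q_mulc -scalerAr mulr1.
have qr : ((q%:C : C)^*)%R = q%:C by exact: conjc_real.
have q2r : ((q%:C ^+ 2 : C)^*)%R = q%:C ^+ 2 by rewrite rmorphXn /= qr.
case=> /=; rewrite ?cM ?qr ?q2r ?S3q_mulc.
- exact: S3q_csas.
- exact: S3q_ac.
- exact: S3q_cas.
- exact: S3q_acs.
- exact: S3q_ccs.
- by rewrite rmorph1; apply: S3q_asa.
- by rewrite rmorph1; apply: S3q_aas.
Qed.

Lemma starD x y : star (x + y) = star x + star y.
Proof. exact: (pliftD conj_cstC star_rel). Qed.

Lemma starM x y : star (x * y) = star y * star x.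
Proof. exact: (pliftM conj_cstC star_rel). Qed.

Lemma star_cst z : star z%:A = z^*%:A.
Proof. by rewrite -S3q_pcstE; apply: (plift_cst conj_cstC star_rel). Qed.

Lemma star_generators :
  [/\ star ga = gas, star gas = ga, star gc = gcs & star gcs = gc].
Proof. by split; apply: (plift_gen conj_cstC star_rel). Qed.

Lemma starZ z x : star (z *: x) = z^* *: star x.
Proof. by rewrite -[x in LHS]mul1r scalerAl starM star_cst -scalerAr mulr1. Qed.

Lemma starK : involutive star.
Proof.
have [sa sas sc scs] := star_generators.
apply: S3q_ind => [z|||||x y sx sy|x y sx sy]; rewrite ?(sa, sas, sc, scs) //.
- by rewrite !star_cst conjCK.
- by rewrite !starD sx sy.
- by rewrite !starM sx sy.
Qed.

End QuantumSphere.

Section QuantumEnvelopingAlgebra.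
Variables (R : realType) (q : R).
Local Notation C := R[i].

(* [UKi] stands for K^-1. *)
Inductive uq_gen := UE | UF | UK | UKi.

Local Notation E := (Gen UE).
Local Notation F := (Gen UF).
Local Notation K := (Gen UK).
Local Notation Ki := (Gen UKi).

Inductive uq_rel : term C uq_gen -> term C uq_gen -> Prop :=
| rel_KKi : uq_rel (K * Ki) (Cst 1)
| rel_KiK : uq_rel (Ki * K) (Cst 1)
| rel_KE : uq_rel (K * E) (q%:C *: (E * K))
| rel_KiE : uq_rel (Ki * E) (q%:C^-1 *: (E * Ki))
| rel_KF : uq_rel (K * F) (q%:C^-1 *: (F * K))
| rel_KiF : uq_rel (Ki * F) (q%:C *: (F * Ki))
| rel_EF : uq_rel (E * F - F * E)
                  ((q%:C - q%:C^-1)^-1 *: (K * K - Ki * Ki)).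

Definition Uq := presalg uq_rel.
HB.instance Definition _ := GRing.PzRing.on Uq.
HB.instance Definition _ := GRing.Lmodule.on Uq.

Definition counit_gen (g : uq_gen) : C :=
  match g with UE | UF => 0 | UK | UKi => 1 end.

Definition counit (h : Uq) : C := plift idfun counit_gen h.

Lemma counit_rel s t : uq_rel s t ->
  peval idfun counit_gen s = peval idfun counit_gen t.
Proof. by case=> /=; rewrite ?(mulr1, mulr0, mul0r, addr0, subrr). Qed.

Lemma counit_cst z : counit (pcst _ z) = z.
Proof. by apply: (plift_cst _ counit_rel) => ? ?; rewrite mulrC. Qed.

Lemma counitD g h : counit (g + h) = counit g + counit h.
Proof. by apply: (pliftD _ counit_rel) => ? ?; rewrite mulrC. Qed.

Lemma counitM g h : counit (g * h) = counit g * counit h.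
Proof. by apply: (pliftM _ counit_rel) => ? ?; rewrite mulrC. Qed.

Lemma counit_generators :
  [/\ counit (pgen _ UE) = 0, counit (pgen _ UF) = 0,
      counit (pgen _ UK) = 1 & counit (pgen _ UKi) = 1].
Proof. by split; apply: (plift_gen _ counit_rel) => ? ?; rewrite mulrC. Qed.

Lemma Uq_one_neq0 : (1 : Uq) != 0.
Proof.
apply/eqP => /(congr1 counit).
by rewrite -(rmorph1 (pcst _)) -(rmorph0 (pcst _)) !counit_cst => /eqP;
   rewrite oner_eq0.
Qed.

HB.instance Definition _ := GRing.PzSemiRing_isNonZero.Build Uq Uq_one_neq0.
HB.instance Definition _ := GRing.Lmodule_isLalgebra.Build C Uq
  (@pscaleAl _ _ _).
HB.instance Definition _ := GRing.Lalgebra_isAlgebra.Build C Uq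
  (@pscaleAr _ _ _).

Definition uE : Uq := pgen uq_rel UE.
Definition uF : Uq := pgen uq_rel UF.
Definition uK : Uq := pgen uq_rel UK.
Definition uKi : Uq := pgen uq_rel UKi.

End QuantumEnvelopingAlgebra.

Section Action.
Variables (R : realType) (q : R).
Local Notation C := R[i].
Local Notation S := (S3q q).
Local Notation U := (Uq q).
Local Notation a := (ga q).
Local Notation as_ := (gas q).
Local Notation c := (gc q).
Local Notation cs := (gcs q).

Definition sqrtq : C := (Num.sqrt q)%:C.

(* The algebra endomorphism scaling a, c by s^-1 and a^*, c^* by s. *)
Definition opK_gen (s : C) (g : sphere_gen) : S :=
  match g with
  | Sa => s^-1 *: a
  | Sas => s *: as_
  | Sc => s^-1 *: c
  | Scs => s *: cs
  end.

(* These operators and [act] are defined through representatives; they respect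
   the relations, hence are well defined, when 0 < q and q != 1. *)
Definition opK : S -> S :=
  plift (B := S) (pcst (@sphere_rel R q)) (opK_gen sqrtq).
Definition opKi : S -> S :=
  plift (B := S) (pcst (@sphere_rel R q)) (opK_gen sqrtq^-1).

Definition opE_gen (g : sphere_gen) : S :=
  match g with Sa => - q%:C *: cs | Sc => as_ | Sas | Scs => 0 end.

Definition opF_gen (g : sphere_gen) : S :=
  match g with Sa | Sc => 0 | Sas => c | Scs => - q%:C^-1 *: a end.

(* Delta(E) = E (x) K + K^-1 (x) E, and similarly for F. *)
Definition opE : S -> S := skew opK opKi opE_gen.
Definition opF : S -> S := skew opK opKi opF_gen.

Definition op_gen (g : uq_gen) : S -> S :=
  match g with UE => opE | UF => opF | UK => opK | UKi => opKi end.

Fixpoint act_term (t : term C uq_gen) (f : S) : S :=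
  match t with
  | Cst z => z *: f
  | Gen g => op_gen g f
  | Add s t => act_term s f + act_term t f
  | Mul s t => act_term s (act_term t f)
  end.

Definition act (h : U) (f : S) : S := act_term (repr h) f.

Hypothesis q_gt0 : 0 < q.
Hypothesis q_neq1 : q != 1.

Lemma qC_neq0 : q%:C != 0 :> C.
Proof. by rewrite eqE /= negb_and gt_eqF. Qed.

Lemma sqrtq_sqr : sqrtq * sqrtq = q%:C.
Proof. by rewrite /sqrtq -rmorphM /= -expr2 sqr_sqrtr // ltW. Qed.

Lemma sqrtq_neq0 : sqrtq != 0.
Proof. by apply: contraTneq qC_neq0 => e; rewrite -sqrtq_sqr e mul0r eqxx. Qed.

Local Notation pc := (pcst (@sphere_rel R q)).

Lemma pcM z (x : S) : pc z * x = z *: x. Proof. by []. Qed.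

Lemma pcC z (x : S) : pc z * x = x * pc z. Proof. exact: pcstC. Qed.

Lemma scaleMM y z (u v : S) : (y *: u) * (z *: v) = (y * z) *: (u * v).
Proof. by rewrite -scalerAl -scalerAr scalerA. Qed.

Lemma opK_eval_rel s : s != 0 ->
  forall u v, sphere_rel q u v ->
  peval (B := S) pc (opK_gen s) u = peval (B := S) pc (opK_gen s) v.
Proof.
move=> s0 u v; case=> /=; rewrite ?pcM ?scaleMM ?(mulVf s0, mulfV s0, scale1r) //.
- by rewrite S3q_ac !scalerA; congr (_ *: _); rewrite mulrC.
- by rewrite S3q_csas !scalerA; congr (_ *: _); rewrite mulrC.
- exact: S3q_acs.
- exact: S3q_cas.
- exact: S3q_ccs.
- by rewrite S3q_asa rmorph1.
- by rewrite S3q_aas rmorph1.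
Qed.

Lemma sqrtqV_neq0 : sqrtq^-1 != 0.
Proof. by rewrite invr_eq0 sqrtq_neq0. Qed.

Lemma opKD x y : opK (x + y) = opK x + opK y.
Proof. exact: (pliftD pcC (opK_eval_rel sqrtq_neq0)). Qed.
Lemma opKiD x y : opKi (x + y) = opKi x + opKi y.
Proof. exact: (pliftD pcC (opK_eval_rel sqrtqV_neq0)). Qed.
Lemma opKM x y : opK (x * y) = opK x * opK y.
Proof. exact: (pliftM pcC (opK_eval_rel sqrtq_neq0)). Qed.
Lemma opKiM x y : opKi (x * y) = opKi x * opKi y.
Proof. exact: (pliftM pcC (opK_eval_rel sqrtqV_neq0)). Qed.
Lemma opK_cst z : opK (pc z) = pc z.
Proof. exact: (plift_cst pcC (opK_eval_rel sqrtq_neq0)). Qed.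
Lemma opKi_cst z : opKi (pc z) = pc z.
Proof. exact: (plift_cst pcC (opK_eval_rel sqrtqV_neq0)). Qed.
Lemma opK_g g : opK (pgen _ g) = opK_gen sqrtq g.
Proof. exact: (plift_gen pcC (opK_eval_rel sqrtq_neq0)). Qed.
Lemma opKi_g g : opKi (pgen _ g) = opK_gen sqrtq^-1 g.
Proof. exact: (plift_gen pcC (opK_eval_rel sqrtqV_neq0)). Qed.

Lemma opKZ z x : opK (z *: x) = z *: opK x.
Proof. by rewrite -!pcM opKM opK_cst. Qed.
Lemma opKiZ z x : opKi (z *: x) = z *: opKi x.
Proof. by rewrite -!pcM opKiM opKi_cst. Qed.

Lemma asaE : as_ * a = 1 - cs * c.
Proof. by rewrite -(S3q_asa q) addrK. Qed.

Lemma aasE : a * as_ = 1 - q%:C ^+ 2 *: (cs * c).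
Proof. by rewrite -(S3q_aas q) S3q_ccs addrK. Qed.

Lemma lin2 (x y : S) (u1 u2 v1 v2 : C) :
  u1 = v1 -> u2 = v2 -> u1 *: x + u2 *: y = v1 *: x + v2 *: y.
Proof. by move=> -> ->. Qed.

Lemma opE_rel u v : sphere_rel q u v ->
  skew_eval opK opKi opE_gen u = skew_eval opK opKi opE_gen v.
Proof.
have t0 := sqrtq_neq0; have Q2 := sqrtq_sqr.
case; rewrite /= ?(clsD, clsM) -?/(pcst _ _) -?/(pgen _ _) ?opKM ?opKiM ?opK_cst ?opKi_cst ?opK_g ?opKi_g /= ?(mul0r, mulr0, add0r, addr0, @invrK C, pcM, =^~ @scalerAl C S, =^~ @scalerAr C S, scalerA, scalerDr, rmorph1, scaler0).
all: rewrite ?(S3q_csas, S3q_ccs, aasE, asaE) ?scalerBr ?scalerA -?Q2.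
all: rewrite ?scale0r ?add0r //.
- rewrite -!scaleNr addrCA -addrA -!scalerDl.
  by apply: lin2; field.
- by congr (_ *: _); field.
- by congr (_ *: _); field.
- by congr (_ *: _); field.
- by rewrite -scalerDl -[RHS](scale0r (as_ * cs)); congr (_ *: _); field.
- by rewrite -scalerDl -[RHS](scale0r (as_ * cs)); congr (_ *: _); field.
Qed.

Lemma opF_rel u v : sphere_rel q u v ->
  skew_eval opK opKi opF_gen u = skew_eval opK opKi opF_gen v.
Proof.
have t0 := sqrtq_neq0; have Q2 := sqrtq_sqr.
case; rewrite /= ?(clsD, clsM) -?/(pcst _ _) -?/(pgen _ _) ?opKM ?opKiM ?opK_cst ?opKi_cst ?opK_g ?opKi_g /= ?(mul0r, mulr0, add0r, addr0, @invrK C, pcM, =^~ @scalerAl C S, =^~ @scalerAr C S, scalerA, scalerDr, rmorph1, scaler0).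
all: rewrite ?(S3q_ac, S3q_ccs, aasE, asaE) ?scalerBr ?scalerA -?Q2.
all: rewrite ?scale0r ?add0r //.
- rewrite -!scaleNr addrCA -addrA -!scalerDl.
  by apply: lin2; field.
- by congr (_ *: _); field.
- by congr (_ *: _); field.
- by congr (_ *: _); field.
- by rewrite -scalerDl -[RHS](scale0r (c * a)); congr (_ *: _); field.
- by rewrite -scalerDl -[RHS](scale0r (c * a)); congr (_ *: _); field.
Qed.

Lemma opED x y : opE (x + y) = opE x + opE y.
Proof. exact: (skewD opK_cst opKD opKM opKi_cst opKiD opKiM opE_rel). Qed.
Lemma opFD x y : opF (x + y) = opF x + opF y.
Proof. exact: (skewD opK_cst opKD opKM opKi_cst opKiD opKiM opF_rel). Qed.
Lemma opEM x y : opE (x * y) = opE x * opK y + opKi x * opE y.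
Proof. exact: (skewM opK_cst opKD opKM opKi_cst opKiD opKiM opE_rel). Qed.
Lemma opFM x y : opF (x * y) = opF x * opK y + opKi x * opF y.
Proof. exact: (skewM opK_cst opKD opKM opKi_cst opKiD opKiM opF_rel). Qed.
Lemma opE_cst z : opE (pc z) = 0.
Proof. exact: (skew_cst opK_cst opKD opKM opKi_cst opKiD opKiM opE_rel). Qed.
Lemma opF_cst z : opF (pc z) = 0.
Proof. exact: (skew_cst opK_cst opKD opKM opKi_cst opKiD opKiM opF_rel). Qed.
Lemma opE_g g : opE (pgen _ g) = opE_gen g.
Proof. exact: (skew_gen opK_cst opKD opKM opKi_cst opKiD opKiM opE_rel). Qed.
Lemma opF_g g : opF (pgen _ g) = opF_gen g.
Proof. exact: (skew_gen opK_cst opKD opKM opKi_cst opKiD opKiM opF_rel). Qed.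

Lemma opEZ z x : opE (z *: x) = z *: opE x.
Proof. by rewrite -!pcM opEM opE_cst opKi_cst mul0r add0r. Qed.
Lemma opFZ z x : opF (z *: x) = z *: opF x.
Proof. by rewrite -!pcM opFM opF_cst opKi_cst mul0r add0r. Qed.

Lemma opgenD g x y : op_gen g (x + y) = op_gen g x + op_gen g y.
Proof. by case: g; [exact: opED|exact: opFD|exact: opKD|exact: opKiD]. Qed.
Lemma opgenZ g z x : op_gen g (z *: x) = z *: op_gen g x.
Proof. by case: g; [exact: opEZ|exact: opFZ|exact: opKZ|exact: opKiZ]. Qed.

Lemma opKKi x : opK (opKi x) = x.
Proof.
have t0 := sqrtq_neq0; elim/cls_ind: x => [z|g|x y hx hy|x y hx hy].
- by rewrite opKi_cst opK_cst.
- by rewrite opKi_g; case: g => /=; rewrite opKZ opK_g /= scalerA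
    ?(mulfV t0, mulVf t0, invrK) ?scale1r.
- by rewrite opKiD opKD hx hy.
- by rewrite opKiM opKM hx hy.
Qed.

Lemma opKiK x : opKi (opK x) = x.
Proof.
have t0 := sqrtq_neq0; elim/cls_ind: x => [z|g|x y hx hy|x y hx hy].
- by rewrite opK_cst opKi_cst.
- by rewrite opK_g; case: g => /=; rewrite opKiZ opKi_g /= scalerA
    ?(mulfV t0, mulVf t0, invrK) ?scale1r.
- by rewrite opKD opKiD hx hy.
- by rewrite opKM opKiM hx hy.
Qed.

Lemma opK0 : opK 0 = 0. Proof. by rewrite -(scale0r 0) opKZ !scale0r. Qed.
Lemma opKi0 : opKi 0 = 0. Proof. by rewrite -(scale0r 0) opKiZ !scale0r. Qed.

Lemma opE0 : opE 0 = 0. Proof. by rewrite -(scale0r 0) opEZ !scale0r. Qed.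
Lemma opF0 : opF 0 = 0. Proof. by rewrite -(scale0r 0) opFZ !scale0r. Qed.

Lemma opKE x : opK (opE x) = q%:C *: opE (opK x).
Proof.
have t0 := sqrtq_neq0; elim/cls_ind: x => [z|g|x y hx hy|x y hx hy].
- by rewrite opK_cst opE_cst opK0 scaler0.
- by rewrite opE_g opK_g; case: g; rewrite /= ?opEZ ?opE_g /= ?opKZ ?opK0
    ?opK_g /= ?scaler0 // !scalerA -sqrtq_sqr; congr (_ *: _); field.
- by rewrite opED !opKD opED hx hy scalerDr.
- rewrite opEM opKD !opKM opEM hx hy opKKi opKiK scalerDr.
  by rewrite -scalerAl -scalerAr.
Qed.

Lemma opKF x : opK (opF x) = q%:C^-1 *: opF (opK x).
Proof.
have t0 := sqrtq_neq0; elim/cls_ind: x => [z|g|x y hx hy|x y hx hy].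
- by rewrite opK_cst opF_cst opK0 scaler0.
- by rewrite opF_g opK_g; case: g; rewrite /= ?opFZ ?opF_g /= ?opKZ ?opK0
    ?opK_g /= ?scaler0 // !scalerA -sqrtq_sqr; congr (_ *: _); field.
- by rewrite opFD !opKD opFD hx hy scalerDr.
- rewrite opFM opKD !opKM opFM hx hy opKKi opKiK scalerDr.
  by rewrite -scalerAl -scalerAr.
Qed.

Lemma opKiE x : opKi (opE x) = q%:C^-1 *: opE (opKi x).
Proof.
rewrite -{1}[x]opKKi -[opE (opK _)]scale1r -(mulVf qC_neq0) -scalerA -opKE.
by rewrite opKiZ opKiK.
Qed.

Lemma opKiF x : opKi (opF x) = q%:C *: opF (opKi x).
Proof.
rewrite -{1}[x]opKKi -[opF (opK _)]scale1r -(mulfV qC_neq0) -scalerA -opKF.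
by rewrite opKiZ opKiK.
Qed.

Lemma qqV_neq0 : q%:C - q%:C^-1 != 0 :> C.
Proof.
rewrite subr_eq0; apply: contra q_neq1 => /eqP e.
have : q%:C ^+ 2 = 1 :> C by rewrite expr2 {2}e mulfV // qC_neq0.
rewrite -rmorphXn -(rmorph1 (real_complex R)) => /complexI /eqP.
by rewrite sqrf_eq1 => /orP[//|/eqP qN1]; move: q_gt0; rewrite qN1 oppr_gt0 ltr10.
Qed.

Lemma opEF x : opE (opF x) - opF (opE x) =
  (q%:C - q%:C^-1)^-1 *: (opK (opK x) - opKi (opKi x)).
Proof.
have t0 := sqrtq_neq0; have w0 := qqV_neq0.
elim/cls_ind: x => [z|g|x y hx hy|x y hx hy].
- by rewrite !opK_cst !opKi_cst !(opE_cst, opF_cst) ?opE0 ?opF0 !subrr scaler0.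
- rewrite opE_g opF_g opK_g opKi_g; move: w0; rewrite -sqrtq_sqr => w0.
  have eN : sqrtq^-1 / sqrtq - sqrtq^-1^-1 / sqrtq^-1
      = - (sqrtq * sqrtq - (sqrtq * sqrtq)^-1) by field.
  have eP : sqrtq * sqrtq - sqrtq^-1 / sqrtq
      = sqrtq * sqrtq - (sqrtq * sqrtq)^-1 by field.
  case: g => /=; rewrite ?opE0 ?opF0 ?opEZ ?opFZ ?opE_g ?opF_g /= ?opKZ ?opKiZ
    ?opK_g ?opKi_g /= ?scalerA -?scalerBl ?scalerA ?sub0r ?subr0.
  + by rewrite mulrNN mulfV ?qC_neq0 // eN mulrN mulVf // scaleN1r scale1r.
  + by rewrite eP mulVf // scale1r.
  + by rewrite eN mulrN mulVf // scaleN1r.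
  + by rewrite mulrNN mulVf ?qC_neq0 // eP mulVf // !scale1r.
- rewrite !(opED, opFD, opKD, opKiD) opprD addrACA hx hy -scalerDr opprD.
  by rewrite addrACA.
- rewrite !(opEM, opFM, opED, opFD) !(opKF, opKE, opKiE, opKiF) !opKM !opKiM.
  rewrite -!scalerAl -!scalerAr !opprD.
  have eS (x1 v w x2 x3 x4 : S) : x1 + v + (w + x2) + (- x3 - w + (- v - x4))
      = (x1 - x3) + (x2 - x4).
    rewrite (addrACA (- x3)) (addrACA (x1 + v)) (addrACA x1) (addrACA w).
    by rewrite !subrr addr0 add0r.
  rewrite eS -mulrBl -mulrBr hx hy -scalerAl -scalerAr -scalerDr mulrBl mulrBr.
  by congr (_ *: _); rewrite addrA subrK.
Qed.

Lemma act_termD t x y : act_term t (x + y) = act_term t x + act_term t y.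
Proof.
elim: t x y => [z|g|s ihs t iht|s ihs t iht] x y /=.
- exact: scalerDr.
- exact: opgenD.
- by rewrite ihs iht addrACA.
- by rewrite iht ihs.
Qed.

Lemma act_termZ t z x : act_term t (z *: x) = z *: act_term t x.
Proof.
elim: t x => [y|g|s ihs t iht|s ihs t iht] x /=.
- by rewrite !scalerA mulrC.
- exact: opgenZ.
- by rewrite ihs iht scalerDr.
- by rewrite iht ihs.
Qed.

Lemma act_term_cong s t : cong (@uq_rel R q) s t ->
  forall x, act_term s x = act_term t x.
Proof.
elim=> {s t} /=.
- move=> s t; case=> x /=.
  + by rewrite opKKi scale1r.
  + by rewrite opKiK scale1r.
  + exact: opKE.
  + exact: opKiE.
  + exact: opKF.
  + exact: opKiF.
  + by rewrite !scaleN1r opEF.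
- by [].
- by move=> s t _ ih x; rewrite ih.
- by move=> s t u _ ih1 _ ih2 x; rewrite ih1.
- by move=> s s' t t' _ ih1 _ ih2 x; rewrite ih1 ih2.
- by move=> s s' t t' _ ih1 _ ih2 x; rewrite ih2 ih1.
- by move=> *; rewrite addrA.
- by move=> *; rewrite addrC.
- by move=> *; rewrite scale0r add0r.
- by move=> *; rewrite scaleN1r subrr scale0r.
- by [].
- by move=> *; rewrite scale1r.
- by [].
- by move=> *; rewrite act_termD.
- by move=> *; rewrite scalerDl.
- by move=> *; rewrite scalerA.
- by move=> *; rewrite act_termZ.
Qed.

Lemma act_cls t x : act (cls (@uq_rel R q) t) x = act_term t x.
Proof. exact/act_term_cong/cong_repr. Qed.

Lemma act_generators x :
  [/\ act (uE q) x = opE x, act (uF q) x = opF x,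
      act (uK q) x = opK x & act (uKi q) x = opKi x].
Proof. by split; apply: act_cls. Qed.

Lemma actDl g h x : act (g + h) x = act g x + act h x.
Proof. by rewrite -[g]clsK -[h]clsK -clsD !act_cls. Qed.

Lemma actM g h x : act (g * h) x = act g (act h x).
Proof. by rewrite -[g]clsK -[h]clsK -clsM !act_cls. Qed.

Lemma act_cst z x : act (pcst (@uq_rel R q) z) x = z *: x.
Proof. exact: act_cls. Qed.

Lemma act1 x : act 1 x = x.
Proof. exact: etrans (act_cst 1 x) (scale1r x). Qed.

Lemma actZl z h x : act (z *: h) x = z *: act h x.
Proof. by rewrite pscaleE actM act_cst. Qed.

Lemma actDr h x y : act h (x + y) = act h x + act h y.
Proof. exact: act_termD. Qed.

Lemma actZr h z x : act h (z *: x) = z *: act h x.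
Proof. exact: act_termZ. Qed.

Lemma act_unit h : act h 1 = (counit h)%:A.
Proof.
have [cE cF cK cKi] := counit_generators q.
have e1 : 1 = pc 1 :> S by [].
elim/cls_ind: h => [z|g|g h hg hh|g h hg hh].
- by rewrite act_cst counit_cst.
- rewrite [LHS](act_cls (Gen g)); case: g => /=.
  + by rewrite [in LHS]e1 opE_cst cE scale0r.
  + by rewrite [in LHS]e1 opF_cst cF scale0r.
  + by rewrite [in LHS]e1 opK_cst cK scale1r.
  + by rewrite [in LHS]e1 opKi_cst cKi scale1r.
- by rewrite actDl hg hh counitD scalerDl.
- by rewrite actM hh actZr hg counitM scalerA mulrC.
Qed.

Lemma act_E :
  [/\ act (uE q) a = - q%:C *: cs, act (uE q) c = as_,
      act (uE q) as_ = 0 & act (uE q) cs = 0].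
Proof. by split; rewrite [LHS]act_cls /= opE_g //= ?invrK. Qed.

Lemma act_F :
  [/\ act (uF q) a = 0, act (uF q) c = 0,
      act (uF q) as_ = c & act (uF q) cs = - q%:C^-1 *: a].
Proof. by split; rewrite [LHS]act_cls /= opF_g //= ?invrK. Qed.

Lemma act_K :
  [/\ act (uK q) a = sqrtq^-1 *: a, act (uK q) c = sqrtq^-1 *: c,
      act (uK q) as_ = sqrtq *: as_ & act (uK q) cs = sqrtq *: cs].
Proof. by split; rewrite [LHS]act_cls /= opK_g //= ?invrK. Qed.

Lemma act_Ki :
  [/\ act (uKi q) a = sqrtq *: a, act (uKi q) c = sqrtq *: c,
      act (uKi q) as_ = sqrtq^-1 *: as_ & act (uKi q) cs = sqrtq^-1 *: cs].
Proof. by split; rewrite [LHS]act_cls /= opKi_g //= ?invrK. Qed.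

Lemma act_coproduct x y :
  [/\ act (uE q) (x * y) = act (uE q) x * act (uK q) y
                           + act (uKi q) x * act (uE q) y,
      act (uF q) (x * y) = act (uF q) x * act (uK q) y
                           + act (uKi q) x * act (uF q) y,
      act (uK q) (x * y) = act (uK q) x * act (uK q) y &
      act (uKi q) (x * y) = act (uKi q) x * act (uKi q) y].
Proof.
split; rewrite ![act _ _]act_cls /=.
- exact: opEM.
- exact: opFM.
- exact: opKM.
- exact: opKiM.
Qed.

End Action.

Section TangentSpace.
Variables (R : realType) (q : R).
Local Notation C := R[i].
Local Notation E := (uE q).
Local Notation F := (uF q).
Local Notation K := (uK q).

Inductive direction := Xplus | Xminus | Xz.

Definition uX (d : direction) : Uq q :=
  match d with
  | Xplus => sqrtq q *: (E * K)
  | Xminus => (sqrtq q)^-1 *: (F * K)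
  | Xz => (1 - q%:C ^- 2)^-1 *: (1 - K ^+ 4)
  end.

Definition sigma (d : direction) : Uq q :=
  match d with Xplus | Xminus => K ^+ 2 | Xz => K ^+ 4 end.

Lemma act_X : 0 < q -> q != 1 -> forall d f g,
  act (uX d) (f * g) = f * act (uX d) g + act (uX d) f * act (sigma d) g.
Proof.
move=> q0 q1.
have aM := actM q0 q1.
have aK f g : act K (f * g) = act K f * act K g.
  by have [] := act_coproduct q0 q1 f g.
have aKi f : act (uKi q) (act K f) = f.
  have [_ _ -> _] := act_generators q0 q1 f.
  have [_ _ _ ->] := act_generators q0 q1 (opK f).
  exact: opKiK.
case=> f g; rewrite /= !(actZl q0 q1).
- have [e _ _ _] := act_coproduct q0 q1 (act K f) (act K g).
  by rewrite !aM aK e aKi scalerDr addrC -scalerAl -scalerAr.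
- have [_ e _ _] := act_coproduct q0 q1 (act K f) (act K g).
  by rewrite !aM aK e aKi scalerDr addrC -scalerAl -scalerAr.
- have act4 h : act (1 - K ^+ 4) h = h - act (K ^+ 4) h.
    by rewrite -scaleN1r actDl // act1 // actZl // scaleN1r.
  have aK4 : act (K ^+ 4) (f * g) = act (K ^+ 4) f * act (K ^+ 4) g.
    by rewrite !exprS expr0 mulr1 !aM !aK.
  rewrite !act4 aK4 -scalerAl -scalerAr -scalerDr; congr (_ *: _).
  by rewrite mulrBr mulrBl addrA subrK.
Qed.

Definition in_TS : {pred Uq q} := fun u =>
  `[< exists x y z : C, u = x *: uX Xplus + y *: uX Xminus + z *: uX Xz >].

Lemma in_TS_submod_closed : submod_closed in_TS.
Proof.
split=> [|w u v].
  by apply/asboolP; exists 0, 0, 0; rewrite !scale0r !addr0.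
move=> /asboolP[x [y [z ->]]] /asboolP[x' [y' [z' ->]]]; apply/asboolP.
exists (w * x + x'), (w * y + y'), (w * z + z').
move: (uX Xplus) (uX Xminus) (uX Xz) => t1 t2 t3.
by rewrite !scalerDr !scalerA !scalerDl addrACA (addrACA ((w * x) *: _)).
Qed.

HB.instance Definition _ :=
  GRing.isSubmodClosed.Build C (Uq q) in_TS in_TS_submod_closed.

(* The tangent space is the span of the [uX d] inside [Uq q]. *)
Record TS : Type := TangentVector {
  TS_val :> Uq q;
  TS_valP : TS_val \in in_TS
}.

HB.instance Definition _ := [isSub for TS_val].
HB.instance Definition _ := [Choice of TS by <:].
HB.instance Definition _ := [SubChoice_isSubLmodule of TS by <:].

Lemma X_in_TS d : uX d \in in_TS.
Proof.
apply/asboolP; case: d.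
- by exists 1, 0, 0; rewrite !scale0r !addr0 scale1r.
- by exists 0, 1, 0; rewrite !scale0r addr0 add0r scale1r.
- by exists 0, 0, 1; rewrite !scale0r !add0r scale1r.
Qed.

Definition tX (d : direction) : TS := TangentVector (X_in_TS d).

End TangentSpace.

Section Image.
Variables (A : pzRingType) (V : lmodType A) (p : {linear V -> V}).

Definition in_endo_image : {pred V} := fun v => `[< exists u, v = p u >].

Lemma in_endo_image_submod_closed : submod_closed in_endo_image.
Proof.
split=> [|x u v]; first by apply/asboolP; exists 0; rewrite linear0.
move=> /asboolP[u' ->] /asboolP[v' ->]; apply/asboolP.
by exists (x *: u' + v'); rewrite linearP.
Qed.

HB.instance Definition _ :=
  GRing.isSubmodClosed.Build A V in_endo_image in_endo_image_submod_closed.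

Record endo_image : Type := EndoImage {
  endo_image_val :> V;
  endo_image_valP : endo_image_val \in in_endo_image
}.

HB.instance Definition _ := [isSub for endo_image_val].
HB.instance Definition _ := [Choice of endo_image by <:].
HB.instance Definition _ := [SubChoice_isSubLmodule of endo_image by <:].

Lemma mem_endo_image u : p u \in in_endo_image.
Proof. by apply/asboolP; exists u. Qed.

Definition to_image (u : V) : endo_image := EndoImage (mem_endo_image u).

End Image.

Section Connection.
Variables (R : realType) (q : R).
Local Notation C := R[i].

(* A right module over S3q is a (left) module over the opposite algebra. *)
Definition rmul (M : lmodType (S3q q)^c) (m : M) (f : S3q q) : M :=
  (f : (S3q q)^c) *: m.

(* Its complex vector space structure is the one given by C -> S3q. *)
Definition cscale (M : lmodType (S3q q)^c) (z : C) (m : M) : M := rmul m z%:A.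

Record right_q_affine (M : lmodType (S3q q)^c) (nabla : TS q -> M -> M) : Prop :=
  RightQAffine {
    nabla_linearl : forall m z Y Z,
      nabla (z *: Y + Z) m = cscale z (nabla Y m) + nabla Z m;
    nabla_linearr : forall Y z m n,
      nabla Y (cscale z m + n) = cscale z (nabla Y m) + nabla Y n;
    nabla_leibniz : forall d m f,
      nabla (tX q d) (rmul m f)
        = rmul (nabla (tX q d) m) (act (sigma q d) f) + rmul m (act (uX q d) f)
  }.

End Connection.

(* Main.v *)
Require Import Defs.
From mathcomp Require Import all_boot all_order all_algebra.
From mathcomp Require Import boolp reals.

Import GRing.Theory Num.Theory.
Local Open Scope ring_scope.

(** Applying [p] to the identities for [nabla] preserves them, since [p] is additive and commutes
    with the right action. Only the undifferentiated Leibniz term changes, from [m X(f)] to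
    [p(m) X(f)]; these agree on [p(M)] because an idempotent is the identity on its image
    ([idempotent_fixes_image]). *)

Lemma idempotent_fixes_image (A : pzRingType) (V : lmodType A)
    (p : {linear V -> V}) (p_idem : forall v, p (p v) = p v)
    (v : endo_image p) : p (endo_image_val v) = endo_image_val v.
Proof. by case: v => v /= /asboolP[u ->]. Qed.

Theorem proposition3p6 (R : realType) (q : R) (q_gt0 : 0 < q) (q_neq1 : q != 1)
    (M : lmodType (S3q q)^c) (nabla : TS q -> M -> M)
    (nabla_affine : right_q_affine nabla)
    (p : {linear M -> M}) (p_idem : forall m : M, p (p m) = p m) :
  right_q_affine (M := endo_image p)
    (fun (Y : TS q) (m : endo_image p) =>
       to_image p (nabla Y (endo_image_val m))).
Proof.
have [nablaDl nablaDr nablaM] := nabla_affine.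
have pD m n : p (m + n) = p m + p n by exact: raddfD.
(* Linearity over the opposite algebra is right linearity over [S3q q]. *)
have p_rmul m f : p (rmul m f) = rmul (p m) f by exact: linearZ.
have val_rmul (m : endo_image p) f :
  endo_image_val (rmul m f) = rmul (endo_image_val m) f by exact: GRing.valZ.
have valD (m n : endo_image p) :
  endo_image_val (m + n) = endo_image_val m + endo_image_val n.
  exact: (raddfD (\val : endo_image p -> M)).
have valI : injective (@endo_image_val _ _ p) by exact: val_inj.
have val_to u : endo_image_val (to_image p u) = p u by [].
(* All three identities are checked in [M]; complex scalars become right multiplication by [z%:A],
   so [p_rmul] covers them too. *)
split=> [m z Y Z|Y z m n|d m f]; apply: valI; rewrite /cscale.
- by rewrite valD val_rmul !val_to nablaDl /cscale pD p_rmul.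
- by rewrite valD val_rmul !val_to valD val_rmul nablaDr /cscale pD p_rmul.
- rewrite valD !val_rmul !val_to nablaM pD !p_rmul.
  (* What remains is [p m = m] in the term where [uX d] acts on [f]. *)
  by rewrite idempotent_fixes_image.
Qed.
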